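(* Let $\Delta t>0$ and let $(\phi^n,\psi^n,B^n)_{n\ge 0}$ be a sequence produced by the S-ESAV-CN scheme described in the context, i.e. $\phi^0\in H^6_{per}(\Omega)$, $\psi^0=0$, $B^0=\exp\big(\widetilde E(\phi^0,\psi^0)/C\big)$, $(\phi^1,\psi^1,B^1)$ satisfies the first-step equations, and for every $n\ge1$ $(\phi^{n+1},\psi^{n+1},B^{n+1})$ satisfies the S-ESAV-CN equations. Then $$\int_\Omega \phi^{n+1}\,dx=\int_\Omega\phi^n\,dx=\cdots=\int_\Omega \phi^0\,dx\qquad\text{for all } n\ge 0 .$$
   Context: Let $d\in\{1,2,3\}$, $L>0$, $\Omega=[0,L]^d$ with periodic boundary conditions; $H^6_{per}(\Omega)$ is the space of real-valued periodic $H^6$ functions on $\Omega$. $\phi^n,\psi^n\in H^6_{per}(\Omega)$ and $B^n\in\mathbb{R}$. $(\cdot,\cdot)$ and $\|\cdot\|$ are the $L^2(\Omega)$ inner product and norm. $L^2_0(\Omega)=\{v\in L^2(\Omega):(v,1)=0\}$. For $v\in L_0^2(\Omega)$, $-\Delta^{-1}v$ denotes the unique $\varphi\in H^2_{per}(\Omega)\cap L^2_0(\Omega)$ with $-\Delta\varphi=v$, and $\|v\|_{-1}=\|\nabla\varphi\|=\sqrt{(-\Delta^{-1}v,v)}$. (All $\psi^n$ generated by the scheme have zero mean.) Parameters: $M>0$; $\alpha,\beta\ge 0$ not both zero; $\epsilon\in(0,1)$; $h_{vac}\ge 0$; stabilization parameter $S>0$. Nonlinearities: $F(\phi)=\frac14\phi^4-\frac{\epsilon}{2}\phi^2$,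 $F_{vac}(\phi)=\frac{h_{vac}}{3}(|\phi|^3-\phi^3)$, $f(\phi)=F'(\phi)=\phi^3-\epsilon\phi$, $f_{vac}(\phi)=F_{vac}'(\phi)=h_{vac}(|\phi|-\phi)\phi$. Pseudo energy: $$\widetilde E(\phi,\psi)=\int_\Omega\Big(\frac12(\Delta\phi)^2-|\nabla\phi|^2+\frac12\phi^2+F(\phi)+F_{vac}(\phi)\Big)dx+\frac{\alpha}{2M}\|\psi\|_{-1}^2 .$$ $C>0$ is a constant with $C\ge \widetilde E(\phi^0,\psi^0)$. Notation for a sequence $(g^n)$: $g^{n+1/2}=\frac{g^{n+1}+g^n}{2}$, $g^{\dagger,n+1}=\frac32 g^n-\frac12 g^{n-1}$, $g^{\star,n+1}=2g^n-g^{n-1}$. S-ESAV-CN equations ($n\ge1$): $$\alpha\frac{\psi^{n+1}-\psi^n}{\Delta t}+\beta\psi^{n+1/2}=M\Delta\mu^{n+1/2},$$ $$\mu^{n+1/2}=(\Delta+1)^2\phi^{n+1/2}+\xi^{n+1}\big(f(\phi^{\dagger,n+1})+f_{vac}(\phi^{\dagger,n+1})\big)+S(\phi^{n+1}-\phi^{\star,n+1}),$$ $$\psi^{n+1/2}=\frac{\phi^{n+1}-\phi^n}{\Delta t},\qquad \frac{B^{n+1}-B^n}{\Delta t}=-\frac{\beta B^{n+1}}{CM}\|\psi^{n+1/2}\|_{-1}^2,$$ $$\xi^{n+1}=\frac{B^{\dagger,n+1}}{\exp\big(\widetilde E(\phi^{\dagger,n+1},\psi^{\dagger,n+1})/C\big)}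 .$$ First-step equations: $$\alpha\frac{\psi^1-\psi^0}{\Delta t}+\beta\psi^1=M\Delta\mu^1,\quad \mu^1=(\Delta+1)^2\phi^1+\xi^1\big(f(\phi^0)+f_{vac}(\phi^0)\big)+S(\phi^1-\phi^0),$$ $$\psi^1=\frac{\phi^1-\phi^0}{\Delta t},\quad \frac{B^1-B^0}{\Delta t}=-\frac{\beta B^1}{CM}\|\psi^1\|_{-1}^2,\quad \xi^1=\frac{B^0}{\exp\big(\widetilde E(\phi^0,\psi^0)/C\big)} .$$ *)

(* Defs.v *)
From HB Require Import structures.
From mathcomp Require Import all_boot all_order all_algebra.
From mathcomp Require Import all_classical all_reals all_analysis.

Set Implicit Arguments.
Unset Strict Implicit.
Unset Printing Implicit Defensive.

Import Order.TTheory GRing.Theory Num.Theory.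
Import numFieldNormedType.Exports.

Local Open Scope classical_set_scope.
Local Open Scope ring_scope.

Section measurable_rV.
Context {R : realType} {n : nat}.

Let coord : 'I_n -> 'rV[R]_n -> R := fun i v => v ord0 i.

Let rV_set0 : g_sigma_preimage coord set0.
Proof. exact: sigma_algebra0. Qed.

Let rV_setC A : g_sigma_preimage coord A -> g_sigma_preimage coord (~` A).
Proof. exact: sigma_algebraC. Qed.

Let rV_bigcup (F : (set 'rV[R]_n)^nat) :
  (forall i, g_sigma_preimage coord (F i)) ->
  g_sigma_preimage coord (\bigcup_i (F i)).
Proof. exact: sigma_algebra_bigcup. Qed.

(* The product sigma-algebra, which is the Borel one on 'rV[R]_n. *)
HB.instance Definition _ := @isMeasurable.Build default_measure_display
  'rV[R]_n (g_sigma_preimage coord) rV_set0 rV_setC rV_bigcup.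

Lemma measurable_coord_rV (i : 'I_n) :
  measurable_fun [set: 'rV[R]_n] (fun v : 'rV[R]_n => v ord0 i).
Proof.
move=> _ Y mY; rewrite setTI; apply: sub_sigma_algebra => /=.
rewrite -bigcup_seq/=; exists i => /=; first by rewrite mem_index_enum.
by exists Y => //; rewrite setTI.
Qed.

Lemma measurable_fun_rVP d (T : measurableType d) (f : T -> 'rV[R]_n) :
  (forall i, measurable_fun [set: T] (fun x => f x ord0 i)) ->
  measurable_fun [set: T] f.
Proof.
move=> mf.
have H : g_sigma_preimage (fun i => coord i \o f) `<=` measurable.
  apply: smallest_sub; first exact: sigma_algebra_measurable.
  rewrite -bigcup_seq; apply: bigcup_sub => i _ A [B mB <-].
  exact: mf.
move=> _ A mA; apply: H; rewrite g_sigma_preimage_comp.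
by exists A.
Qed.

End measurable_rV.

Section lebesgue_rV_step.
Context {R : realType} {n : nat}.
Variable mu : {sigma_finite_measure set 'rV[R]_n -> \bar R}.

Definition rV_cons (p : measurableTypeR R * 'rV[R]_n) : 'rV[R]_n.+1 := row_mx p.1%:M p.2.

Definition rV_uncons (v : 'rV[R]_n.+1) : measurableTypeR R * 'rV[R]_n :=
  (v ord0 ord0, @rsubmx R 1 1 n v).

Lemma rV_consK : cancel rV_cons rV_uncons.
Proof.
move=> [x v]; rewrite /rV_uncons /rV_cons row_mxKr; congr pair.
have -> : (ord0 : 'I_n.+1) = lshift n (ord0 : 'I_1) by apply/val_inj.
by rewrite (@row_mxEl R 1 1 n) mxE.
Qed.

Lemma measurable_rV_cons : measurable_fun setT rV_cons.
Proof.
apply: (@measurable_fun_rVP R n.+1 _ (measurableTypeR R * 'rV[R]_n)%type) => i.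
rewrite /rV_cons.
case: (split_ordP (i : 'I_(1 + n))) => j ->.
  rewrite (_ : (fun _ => _) = fst); first exact: measurable_fst.
  by apply/funext => p; rewrite (@row_mxEl R 1 1 n) mxE (ord1 j).
under eq_fun do rewrite (@row_mxEr R 1 1 n).
by apply: (measurableT_comp (measurable_coord_rV j)).
Qed.

Lemma measurable_rV_uncons : measurable_fun setT rV_uncons.
Proof.
apply: measurable_fun_pair; first exact: measurable_coord_rV.
apply: (@measurable_fun_rVP R n _ 'rV[R]_n.+1) => i.
under eq_fun do rewrite mxE.
exact: measurable_coord_rV.
Qed.

Definition lebesgue_rVS : set 'rV[R]_n.+1 -> \bar R :=
  pushforward (@lebesgue_measure R \x mu)%E rV_cons.

Let lebesgue_rVS0 : lebesgue_rVS set0 = 0%E.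
Proof. by rewrite /lebesgue_rVS /pushforward preimage_set0 measure0. Qed.

Let lebesgue_rVS_ge0 A : (0 <= lebesgue_rVS A)%E.
Proof. by rewrite /lebesgue_rVS /pushforward; apply: measure_ge0. Qed.

Let lebesgue_rVS_sigma_additive : semi_sigma_additive lebesgue_rVS.
Proof.
move=> F mF tF mUF; rewrite /lebesgue_rVS /pushforward preimage_bigcup.
have mpre A : measurable A -> measurable (rV_cons @^-1` A).
  by move=> mA; rewrite -[X in measurable X]setTI; exact: measurable_rV_cons.
apply: measure_semi_sigma_additive.
- by move=> k; exact: mpre.
- apply/trivIsetP => /= i j _ _ ij; rewrite -preimage_setI.
  by move/trivIsetP : tF => /(_ _ _ _ _ ij) ->//; rewrite preimage_set0.
- by rewrite -preimage_bigcup; exact: mpre.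
Qed.

HB.instance Definition _ := isMeasure.Build _ _ _ lebesgue_rVS
  lebesgue_rVS0 lebesgue_rVS_ge0 lebesgue_rVS_sigma_additive.

Let lebesgue_rVS_sigma_finite : sigma_finite setT lebesgue_rVS.
Proof.
have /sigma_finiteP[F [FT ndF Foo]] := sigma_finiteT (@lebesgue_measure R).
have /sigma_finiteP[G [GT ndG Goo]] := sigma_finiteT mu.
exists (fun k => rV_uncons @^-1` (F k `*` G k)).
  rewrite -preimage_bigcup -(preimage_setT rV_uncons); congr preimage.
  rewrite -setXTT FT GT predeqE => -[x y]; split.
    move=> [/= [k _ Fkx] [l _ Gly]]; exists (maxn k l) => //; split.
    - by move: x Fkx; exact/subsetPset/ndF/leq_maxl.
    - by move: y Gly; exact/subsetPset/ndG/leq_maxr.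
  by move=> [k _ []/= ? ?]; split; exists k.
move=> k; have [mF Fk] := Foo k; have [mG Gk] := Goo k; split.
  rewrite -[X in measurable X]setTI; apply: measurable_rV_uncons => //.
  exact: measurableX.
rewrite /lebesgue_rVS /pushforward -comp_preimage.
rewrite (_ : rV_uncons \o rV_cons = id) ?preimage_id; last first.
  by apply/funext => p /=; rewrite rV_consK.
by rewrite product_measure1E// lte_mul_pinfty// ge0_fin_numE.
Qed.

HB.instance Definition _ := Measure_isSigmaFinite.Build _ _ _ lebesgue_rVS
  lebesgue_rVS_sigma_finite.

End lebesgue_rV_step.

(* Lebesgue measure on R^n, as an n-fold product measure. *)
Fixpoint lebesgue_rV (R : realType) (n : nat) :
    {sigma_finite_measure set 'rV[R]_n -> \bar R} :=
  if n is k.+1 then lebesgue_rVS (lebesgue_rV R k) else \d_(0 : 'rV[R]_0).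

Section periodic_calculus.
Context {R : realType} {d : nat}.
Variable L : R.
Implicit Types (u v g chi : 'rV[R]_d -> R) (s : seq 'I_d) (k : nat).

Local Notation leb := (lebesgue_rV R d).

Definition Omega : set 'rV[R]_d := [set x | forall i, 0 <= x ord0 i <= L].

Definition int_Omega u : R := \int[leb]_(x in Omega) u x.

Definition eq_Omega u v : Prop := ae_eq leb Omega u v.

Definition in_L2 u : Prop :=
  measurable_fun Omega u /\
  leb.-integrable Omega (fun x => ((u x) ^+ 2)%:E).

Definition mean_zero u : Prop := int_Omega u = 0.

Definition periodic u : Prop := forall x i, u (x + L *: delta_mx 0 i) = u x.

Definition partial (i : 'I_d) u : 'rV[R]_d -> R := fun x => 'D_(delta_mx 0 i) u x.

(* [:: i1; ..; ik] stands for the derivative d_i1 .. d_ik. *)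
Definition partials s u : 'rV[R]_d -> R := foldr partial u s.

Definition smooth u : Prop := forall s,
  continuous (partials s u) /\
  forall x i, derivable (partials s u) x (delta_mx 0 i).

(* Weak derivatives on the torus: the test functions are periodic and not
   compactly supported, so that a weakly differentiable u has no jump across
   the faces of Omega. *)
Definition is_weak_partials s u g : Prop :=
  [/\ in_L2 u, in_L2 g &
    forall chi, smooth chi -> periodic chi ->
      int_Omega (fun x => u x * partials s chi x) =
      (-1) ^+ size s * int_Omega (fun x => g x * chi x)].

Definition in_Hper k u : Prop :=
  periodic u /\ in_L2 u /\
  forall s, (size s <= k)%N -> exists g, is_weak_partials s u g.

(* A representative of the weak derivative, which is unique up to null sets;
   it is 0 by convention when it does not exist in L^2.  The convention plays
   no role in the scheme: for phi in H^6_per and d <= 3 the embedding into C^4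
   puts mu below in H^2_per. *)
Definition weak_partials s u : 'rV[R]_d -> R :=
  xget (fun=> 0) [set g | is_weak_partials s u g].

Definition lap u : 'rV[R]_d -> R :=
  fun x => \sum_(i < d) weak_partials [:: i; i] u x.

Definition grad_sq u : 'rV[R]_d -> R :=
  fun x => \sum_(i < d) weak_partials [:: i] u x ^+ 2.

Definition lap_plus1 u : 'rV[R]_d -> R := fun x => lap u x + u x.

(* -Delta^{-1} v, up to null sets; 0 by convention if the Poisson problem has no solution,
   that is, if v is not in L^2_0. *)
Definition neg_inv_lap v : 'rV[R]_d -> R :=
  xget (fun=> 0) [set w | [/\ in_Hper 2 w, mean_zero w &
                             eq_Omega (fun x => - lap w x) v]].

Definition norm_m1 v : R := Num.sqrt (int_Omega (grad_sq (neg_inv_lap v))).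

End periodic_calculus.

Section model.
Context {R : realType}.

Definition F_bulk (eps r : R) : R := r ^+ 4 / 4 - eps / 2 * r ^+ 2.
Definition F_vac (hvac r : R) : R := hvac / 3 * (`|r| ^+ 3 - r ^+ 3).
Definition f_bulk (eps r : R) : R := r ^+ 3 - eps * r.
Definition f_vac (hvac r : R) : R := hvac * (`|r| - r) * r.

Definition pseudo_energy (d : nat) (L M alpha eps hvac : R)
    (phi psi : 'rV[R]_d -> R) : R :=
  int_Omega L (fun x => lap L phi x ^+ 2 / 2 - grad_sq L phi x
    + phi x ^+ 2 / 2 + F_bulk eps (phi x) + F_vac hvac (phi x))
  + alpha / (2 * M) * norm_m1 L psi ^+ 2.

(* half_step g n = g^{n+1/2}, dagger_step g n = g^{dagger,n+1}, star_step g n = g^{star,n+1};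
   the last two are only used for n >= 1. *)
Definition half_step (g : nat -> R) (n : nat) : R := (g n.+1 + g n) / 2.
Definition dagger_step (g : nat -> R) (n : nat) : R := 3 / 2 * g n - g n.-1 / 2.
Definition star_step (g : nat -> R) (n : nat) : R := 2 * g n - g n.-1.

End model.

Section scheme.
Context {R : realType} {d : nat}.
Variables (L M alpha beta eps hvac S C dt : R).
Variables (phi psi : nat -> 'rV[R]_d -> R) (B : nat -> R).

Definition half_step_fun (g : nat -> 'rV[R]_d -> R) n x := half_step (g ^~ x) n.
Definition dagger_step_fun (g : nat -> 'rV[R]_d -> R) n x := dagger_step (g ^~ x) n.
Definition star_step_fun (g : nat -> 'rV[R]_d -> R) n x := star_step (g ^~ x) n.

Local Notation E := (@pseudo_energy R d L M alpha eps hvac).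

Definition xi_first : R := B 0%N / expR (E (phi 0%N) (psi 0%N) / C).

Definition mu_first (x : 'rV[R]_d) : R :=
  lap_plus1 L (lap_plus1 L (phi 1%N)) x
  + xi_first * (f_bulk eps (phi 0%N x) + f_vac hvac (phi 0%N x))
  + S * (phi 1%N x - phi 0%N x).

Definition first_step : Prop :=
  [/\ eq_Omega L
        (fun x => alpha * ((psi 1%N x - psi 0%N x) / dt) + beta * psi 1%N x)
        (fun x => M * lap L mu_first x),
      eq_Omega L (psi 1%N) (fun x => (phi 1%N x - phi 0%N x) / dt) &
      (B 1%N - B 0%N) / dt =
        - (beta * B 1%N / (C * M)) * norm_m1 L (psi 1%N) ^+ 2].

(* xi_cn n and mu_cn n are xi^{n+1} and mu^{n+1/2}. *)
Definition xi_cn (n : nat) : R :=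
  dagger_step B n / expR (E (dagger_step_fun phi n) (dagger_step_fun psi n) / C).

Definition mu_cn (n : nat) (x : 'rV[R]_d) : R :=
  lap_plus1 L (lap_plus1 L (half_step_fun phi n)) x
  + xi_cn n * (f_bulk eps (dagger_step_fun phi n x) + f_vac hvac (dagger_step_fun phi n x))
  + S * (phi n.+1 x - star_step_fun phi n x).

Definition cn_step (n : nat) : Prop :=
  [/\ eq_Omega L
        (fun x => alpha * ((psi n.+1 x - psi n x) / dt)
                  + beta * half_step_fun psi n x)
        (fun x => M * lap L (mu_cn n) x),
      eq_Omega L (half_step_fun psi n) (fun x => (phi n.+1 x - phi n x) / dt) &
      (B n.+1 - B n) / dt =
        - (beta * B n.+1 / (C * M)) * norm_m1 L (half_step_fun psi n) ^+ 2].

Definition sesav_cn_sequence : Prop :=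
  [/\ forall n, in_Hper L 6 (phi n) /\ in_Hper L 6 (psi n),
      eq_Omega L (psi 0%N) (fun=> 0),
      B 0%N = expR (E (phi 0%N) (psi 0%N) / C),
      first_step &
      forall n, (1 <= n)%N -> cn_step n].

End scheme.

(* Main.v *)
Require Import Defs.
From HB Require Import structures.
From mathcomp Require Import all_boot all_order all_algebra.
From mathcomp Require Import all_classical all_reals all_analysis.
From mathcomp Require Import measurable_realfun ring lra.
Import Order.TTheory GRing.Theory Num.Theory.
Import numFieldNormedType.Exports.
Local Open Scope ring_scope.

(** The equation that advances psi has a Laplacian on its right-hand side, and
    on the torus a Laplacian has mean zero: testing the definition of
    a weak derivative against the constant function 1, whose derivatives
    vanish, shows that any weak derivative of positive order integrates to zero
    ([int_weak_partials]).  This is insensitive to the regularity of the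
    chemical potential: where a weak derivative fails to exist, the value 0
    taken in its place has mean zero too.

    Write p_n for the integral of psi^n.  Integrating the first equation of a
    time step gives
      alpha (p_{n+1} - p_n) / dt + beta (theta p_{n+1} + (1 - theta) p_n) = 0
    with theta = 1 at the first step and theta = 1/2 afterwards.  As alpha and
    beta are nonnegative and not both zero, the coefficient of p_{n+1} is
    positive, so p_0 = 0 propagates to p_n = 0 for all n ([int_psi]).  The
    equation relating psi to the increment of phi then says that the integral
    of phi does not change from one step to the next.

    The measure-theoretic input is that the cell has finite Lebesgue measure,
    so that L^2 functions are integrable on it ([in_L2_integrable]) and the
    integral over it is linear on all functions that occur. *)

(** * Integration over the periodic cell *)

Section mass_conservation.
Local Open Scope classical_set_scope.
Set Implicit Arguments.
Unset Strict Implicit.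
Context {R : realType}.

Lemma measurable_Omega d (L : R) : measurable (@Omega R d L).
Proof.
have -> : @Omega R d L =
    \bigcap_(i in [set: 'I_d]) ((fun v : 'rV[R]_d => v ord0 i) @^-1` `[0, L]).
  apply/seteqP; split => x /= h i.
    by move=> _ /=; rewrite in_itv/=; exact: h.
  by have := h i Logic.I; rewrite /= in_itv.
apply: fin_bigcap_measurable => // i _.
rewrite -[X in measurable X]setTI.
by apply: measurable_coord_rV => //; exact: measurable_itv.
Qed.

(** Splitting off the first coordinate writes the cell as a product, so its
    measure is a finite product of interval lengths. *)
Lemma lebesgue_Omega_fin d (L : R) : (lebesgue_rV R d (Omega L) < +oo)%E.
Proof.
elim: d => [|d IHd].
  by rewrite /= diracE ltry.
rewrite /= /lebesgue_rVS /pushforward.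
have -> : @rV_cons R d @^-1` Omega L = `[0, L] `*` Omega L.
  apply/seteqP; split => -[x v] /=.
    move=> h; split.
      by move: (h ord0); rewrite -[_ ord0 ord0]/(rV_uncons (rV_cons (x, v))).1
        rV_consK in_itv.
    move=> i; move: (h (rshift 1 i)).
    by rewrite /rV_cons (@row_mxEr R 1 1 d).
  move=> [hx hv] i; rewrite /rV_cons.
  case: (split_ordP (i : 'I_(1 + d))) => j ->.
    by rewrite (@row_mxEl R 1 1 d) mxE (ord1 j) /= mulr1n; rewrite in_itv in hx.
  by rewrite (@row_mxEr R 1 1 d); exact: hv.
rewrite product_measure1E//; last exact: measurable_Omega.
apply: lte_mul_pinfty => //.
  rewrite ge0_fin_numE// [X in (X < _)%E](lebesgue_measure_itv `[0, L]%R)/=.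
  by case: ifP => _; rewrite ?ltry.
Qed.

Context {d : nat}.
Variable L : R.
Implicit Types u v : 'rV[R]_d -> R.

Definition integrable_Omega u : Prop :=
  (lebesgue_rV R d).-integrable (Omega L) (EFin \o u).

(** The pointwise bound |u| <= 1 + u^2 replaces Cauchy-Schwarz: the constant 1
    is integrable because the cell has finite measure. *)
Lemma in_L2_integrable u : in_L2 L u -> integrable_Omega u.
Proof.
move=> [mu iu]; have mO := @measurable_Omega d L.
apply: (@le_integrable _ _ _ _ _ mO _ (fun x => 1%:E + (u x ^+ 2)%:E)%E).
- exact/measurable_EFinP.
- move=> x _; rewrite -EFinD !abse_EFin lee_fin.
  rewrite [leRHS]ger0_norm ?addr_ge0 ?sqr_ge0//.
  have := sqr_ge0 (`|u x| - 1); rewrite -(real_normK (num_real (u x))).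
  nra.
- apply: integrableD => //.
  apply/integrableP; split; first exact: measurable_cst.
  under eq_integral do rewrite abse_EFin normr1.
  by rewrite integral_cst// mul1e; exact: lebesgue_Omega_fin.
Qed.

Lemma integrable_Omega_lin a b u v :
  integrable_Omega u -> integrable_Omega v ->
  integrable_Omega (fun x => a * u x + b * v x).
Proof.
move=> iu iv; have mO := @measurable_Omega d L.
have := integrableD mO (integrableZl mO a iu) (integrableZl mO b iv).
exact.
Qed.

Lemma int_Omega_lin a b u v :
  integrable_Omega u -> integrable_Omega v ->
  int_Omega L (fun x => a * u x + b * v x) =
  a * int_Omega L u + b * int_Omega L v.
Proof.
move=> iu iv; have mO := @measurable_Omega d L.
rewrite /int_Omega RintegralD//.
- by rewrite !RintegralZl.
- exact: (integrableZl mO a iu).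
- exact: (integrableZl mO b iv).
Qed.

Lemma eq_int_Omega u v :
  integrable_Omega u -> integrable_Omega v -> eq_Omega L u v ->
  int_Omega L u = int_Omega L v.
Proof.
move=> iu iv uv; have mO := @measurable_Omega d L.
rewrite /int_Omega /Rintegral; congr fine; apply: ae_eq_integral => //.
- exact: measurable_int iu.
- exact: measurable_int iv.
- by apply: filterS uv => x h /h ->.
Qed.

Lemma integrable_Omega0 : integrable_Omega (fun=> 0).
Proof. exact: integrable0. Qed.

Lemma int_Omega0 : int_Omega L (fun _ : 'rV[R]_d => 0) = 0.
Proof. by rewrite /int_Omega /Rintegral integral0. Qed.

(** * Weak derivatives have mean zero *)

Lemma partial_cst (c : R) (i : 'I_d) :
  partial i (cst c : 'rV[R]_d -> R) = cst 0.
Proof. by apply/funext => x; rewrite /partial derive_cst. Qed.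

Lemma partials_cst (c : R) (s : seq 'I_d) :
  s != [::] -> partials s (cst c : 'rV[R]_d -> R) = cst 0.
Proof.
elim: s => // i [|j s] IH _; first exact: partial_cst.
rewrite -[LHS]/(partial i (partials (j :: s) (cst c))) IH//.
exact: partial_cst.
Qed.

Lemma smooth_cst (c : R) : smooth (cst c : 'rV[R]_d -> R).
Proof.
move=> s.
have [e ->] : exists e, partials s (cst c : 'rV[R]_d -> R) = cst e.
  by case: s => [|i s]; [exists c|exists 0; rewrite partials_cst].
split=> [|x i]; first exact: cst_continuous.
exact: derivable_cst.
Qed.

Lemma weak_partialsP s u :
  weak_partials L s u = (fun=> 0) \/
  is_weak_partials L s u (weak_partials L s u).
Proof.
rewrite /weak_partials; case: xgetP => [g _ hg|_]; by [right|left].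
Qed.

Lemma integrable_weak_partials s u : integrable_Omega (weak_partials L s u).
Proof.
have [->|[_ h _]] := weak_partialsP s u; first exact: integrable_Omega0.
exact: in_L2_integrable.
Qed.

(** The constant function 1 is an admissible test function because test
    functions are periodic rather than compactly supported. *)
Lemma int_weak_partials s u :
  s != [::] -> int_Omega L (weak_partials L s u) = 0.
Proof.
move=> s0; have [->|[_ _ h]] := weak_partialsP s u; first exact: int_Omega0.
have := h (cst 1) (smooth_cst 1) (fun _ _ => erefl).
rewrite partials_cst//.
under [X in int_Omega _ X]eq_fun do rewrite /= mulr0.
under [X in _ = _ * int_Omega _ X]eq_fun do rewrite /= mulr1.
rewrite int_Omega0 => /esym/eqP.
by rewrite mulf_eq0 signr_eq0 => /eqP.
Qed.

Lemma lap_mean_zero u : integrable_Omega (lap L u) /\ int_Omega L (lap L u) = 0.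
Proof.
rewrite /lap; elim: (index_enum _) => [|i r [IHi IHz]].
  under eq_fun do rewrite big_nil.
  by split; [exact: integrable_Omega0|exact: int_Omega0].
have iw := integrable_weak_partials [:: i; i] u.
under eq_fun do rewrite big_cons -[X in X + _]mul1r -[X in _ + X]mul1r.
split; first exact: integrable_Omega_lin.
by rewrite int_Omega_lin// IHz int_weak_partials// !mulr0 addr0.
Qed.

(** * Mean values along the scheme *)

(** One time step, with weight theta on the new value in the damping term.
    After integration the Laplacian is gone and u' is left with the factor
    alpha / dt + beta * theta, which is positive. *)
Lemma mean_zero_step (alpha beta M dt theta : R) u u' w :
  0 <= alpha -> 0 <= beta -> ~ (alpha = 0 /\ beta = 0) ->
  0 < dt -> 0 < theta ->
  integrable_Omega u -> integrable_Omega u' -> mean_zero L u ->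
  eq_Omega L
    (fun x => alpha * ((u' x - u x) / dt)
              + beta * (theta * u' x + (1 - theta) * u x))
    (fun x => M * lap L w x) ->
  mean_zero L u'.
Proof.
move=> alpha0 beta0 ab0 dt0 theta0 iu iu' u0 evol.
have [ilap lap0] := lap_mean_zero w.
set a := alpha / dt + beta * theta.
set b := beta * (1 - theta) - alpha / dt.
have a_gt0 : 0 < a.
  have adt : 0 <= alpha / dt by rewrite divr_ge0// ltW.
  have bth : 0 <= beta * theta by rewrite mulr_ge0// ltW.
  rewrite lt_neqAle addr_ge0// andbT eq_sym paddr_eq0//.
  rewrite !mulf_eq0 invr_eq0 (gt_eqF dt0) (gt_eqF theta0) !orbF.
  by apply/negP => /andP[/eqP ? /eqP ?]; apply: ab0.
have lhsE : (fun x => alpha * ((u' x - u x) / dt)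
    + beta * (theta * u' x + (1 - theta) * u x)) =
    (fun x => a * u' x + b * u x).
  by apply/funext => x; rewrite /a /b; ring.
(* The second term only gives the right-hand side the shape of a linear
   combination. *)
have rhsE : (fun x => M * lap L w x) = (fun x => M * lap L w x + 0 * u x).
  by apply/funext => x; rewrite mul0r addr0.
rewrite lhsE rhsE in evol.
have := eq_int_Omega (integrable_Omega_lin a b iu' iu)
  (integrable_Omega_lin M 0 ilap iu) evol.
rewrite !int_Omega_lin// lap0 (u0 : int_Omega L u = 0) !mulr0 !addr0.
by move=> /eqP; rewrite mulf_eq0 (gt_eqF a_gt0) => /eqP.
Qed.

Lemma int_Omega_increment (dt theta : R) u u' v v' :
  0 < dt ->
  integrable_Omega u -> integrable_Omega u' ->
  integrable_Omega v -> integrable_Omega v' ->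
  mean_zero L u -> mean_zero L u' ->
  eq_Omega L (fun x => theta * u' x + (1 - theta) * u x)
    (fun x => (v' x - v x) / dt) ->
  int_Omega L v' = int_Omega L v.
Proof.
move=> dt0 iu iu' iv iv' u0 u'0.
have -> : (fun x => (v' x - v x) / dt) =
          (fun x => dt^-1 * v' x + - dt^-1 * v x).
  by apply/funext => x; ring.
move=> /(eq_int_Omega (integrable_Omega_lin _ _ iu' iu)
  (integrable_Omega_lin _ _ iv' iv)).
rewrite !int_Omega_lin// (u0 : int_Omega L u = 0) (u'0 : int_Omega L u' = 0).
rewrite !mulr0 addr0 mulNr -mulrBr => /esym/eqP.
by rewrite mulf_eq0 invr_eq0 (gt_eqF dt0) subr_eq0 => /eqP.
Qed.

Lemma half_step_funE (g : nat -> 'rV[R]_d -> R) n :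
  half_step_fun g n = (fun x => 2^-1 * g n.+1 x + (1 - 2^-1) * g n x).
Proof. by apply/funext => x; rewrite /half_step_fun /half_step; field. Qed.

(** The first step is backward Euler rather than Crank-Nicolson; both have the
    weighted form of [mean_zero_step], with weight 1 resp. 1/2 on the new
    value. *)
Lemma one_step_funE (g : nat -> 'rV[R]_d -> R) n :
  g n.+1 = (fun x => 1 * g n.+1 x + (1 - 1) * g n x).
Proof. by apply/funext => x; rewrite subrr mul0r addr0 mul1r. Qed.

Section scheme.
Variables (M alpha beta eps hvac S C dt : R).
Variables (phi psi : nat -> 'rV[R]_d -> R) (B : nat -> R).
Hypothesis alpha_ge0 : 0 <= alpha.
Hypothesis beta_ge0 : 0 <= beta.
Hypothesis alpha_beta : ~ (alpha = 0 /\ beta = 0).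
Hypothesis dt_gt0 : 0 < dt.
Hypothesis seqP : sesav_cn_sequence L M alpha beta eps hvac S C dt phi psi B.

Lemma integrable_phi n : integrable_Omega (phi n).
Proof.
by have [/(_ n)[[_ [h _]] _] _ _ _ _] := seqP; exact: in_L2_integrable.
Qed.

Lemma integrable_psi n : integrable_Omega (psi n).
Proof.
by have [/(_ n)[_ [_ [h _]]] _ _ _ _] := seqP; exact: in_L2_integrable.
Qed.

Lemma int_psi n : mean_zero L (psi n).
Proof.
have [_ psi0 _ [evol1 _ _] evol] := seqP.
elim: n => [|n IHn].
  rewrite /mean_zero (eq_int_Omega (integrable_psi 0) integrable_Omega0 psi0).
  exact: int_Omega0.
case: n => [|n] in IHn *.
  apply: (mean_zero_step alpha_ge0 beta_ge0 alpha_beta dt_gt0 ltr01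
    (integrable_psi 0) (integrable_psi 1) IHn).
  (* The damping term is the last occurrence of psi 1. *)
  by move: evol1; rewrite {2}(one_step_funE psi 0); exact.
have [e _ _] := evol n.+1 isT; rewrite half_step_funE in e.
have half_gt0 : 0 < 2^-1 :> R by rewrite invr_gt0.
exact: (mean_zero_step alpha_ge0 beta_ge0 alpha_beta dt_gt0 half_gt0
  (integrable_psi n.+1) (integrable_psi n.+2) IHn e).
Qed.

Lemma int_phi_step n : int_Omega L (phi n.+1) = int_Omega L (phi n).
Proof.
have [_ _ _ [_ incr1 _] evol] := seqP.
have [theta h] : exists theta,
    eq_Omega L (fun x => theta * psi n.+1 x + (1 - theta) * psi n x)
      (fun x => (phi n.+1 x - phi n x) / dt).
  case: n => [|n]; first by exists 1; rewrite -one_step_funE.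
  by exists 2^-1; rewrite -half_step_funE; have [] := evol n.+1 isT.
exact: int_Omega_increment dt_gt0 (integrable_psi n) (integrable_psi n.+1)
  (integrable_phi n) (integrable_phi n.+1) (int_psi n) (int_psi n.+1) h.
Qed.

End scheme.

End mass_conservation.

Theorem theorem3p5 (R : realType) (d : nat) (hd : (1 <= d <= 3)%N)
    (L M alpha beta eps hvac S C dt : R)
    (hL : 0 < L) (hM : 0 < M)
    (halpha : 0 <= alpha) (hbeta : 0 <= beta)
    (hab : ~ (alpha = 0 /\ beta = 0))
    (heps : 0 < eps < 1) (hhvac : 0 <= hvac) (hS : 0 < S) (hdt : 0 < dt)
    (phi psi : nat -> 'rV[R]_d -> R) (B : nat -> R)
    (hC : 0 < C)
    (hCE : pseudo_energy L M alpha eps hvac (phi 0%N) (psi 0%N) <= C)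
    (hseq : sesav_cn_sequence L M alpha beta eps hvac S C dt phi psi B)
    (n : nat) :
  int_Omega L (phi n.+1) = int_Omega L (phi n) /\
  int_Omega L (phi n) = int_Omega L (phi 0%N).
Proof.
have step := int_phi_step halpha hbeta hab hdt hseq.
by split; [exact: step | elim: n => // n IHn; rewrite step].
Qed.
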